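(* Let $p:\mathcal C\to\mathcal D$ be a fibration. Then, for any Grothendieck topology $K$ on $\mathcal D$, the comorphism of sites $p:(\mathcal C,M^p_K)\to(\mathcal D,K)$ is continuous, i.e. $(M^p_K,K)$-continuous.
   Context: For a functor $p:\mathcal C\to\mathcal D$, an arrow $\phi:c'\to c$ of $\mathcal C$ is cartesian if for any $\psi:c''\to c$ in $\mathcal C$ and any $g:p(c'')\to p(c')$ with $p(\phi)\circ g=p(\psi)$ there is a unique $\chi:c''\to c'$ with $\phi\circ\chi=\psi$ and $p(\chi)=g$. The functor $p$ is a fibration (in the sense of Street) if for every arrow $f:d\to p(c)$ in $\mathcal D$ there are a cartesian arrow $\phi:c'\to c$ and an isomorphism $\alpha:p(c')\to d$ with $f\circ\alpha=p(\phi)$. A comorphism of sites $(\mathcal C,J)\to(\mathcal D,K)$ is a functor $p:\mathcal C\to\mathcal D$ such that for every object $c$ and every $K$-covering sieve $S$ on $p(c)$ there is a $J$-covering sieve $R$ on $c$ with $p(R)\subseteq S$. $M^p_K$ is the smallest Grothendieck topology on $\mathcal C$ making $p$ a comorphism of sites to $(\mathcal D,K)$; it is generated by the sieves $\{f:\mathrm{dom}(f)\to c\mid p(f)\in T\}$ for $c\in\mathcal C$ and $T$ a $K$-covering sieve on $p(c)$. A functor $A:\mathcal C\to\mathcal D$ is $(J,K)$-continuous if for every $K$-sheaf $E$ on $\mathcal D$ the presheaf $\mathrm{Hom}_{\mathbf{Sh}(\mathcal D,K)}(l'(A(-)),E)\cong E\circ A^{\mathrm{op}}$ is a $J$-sheaf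 on $\mathcal C$ ($l'$ being Yoneda followed by sheafification). *)

(* Defs.v *)
Set Implicit Arguments.
Unset Strict Implicit.

Record Category : Type := {
  obj :> Type;
  hom : obj -> obj -> Type;
  idc : forall a, hom a a;
  comp : forall a b c, hom b c -> hom a b -> hom a c;
  comp_assoc : forall a b c d (h : hom c d) (g : hom b c) (f : hom a b),
    comp h (comp g f) = comp (comp h g) f;
  comp_id_l : forall a b (f : hom a b), comp (idc b) f = f;
  comp_id_r : forall a b (f : hom a b), comp f (idc a) = f
}.

Arguments hom {c} _ _ : rename.
Arguments idc {c} _ : rename.
Arguments comp {c a b c0} _ _ : rename.

Declare Scope cat_scope.
Delimit Scope cat_scope with cat.
Open Scope cat_scope.
Notation "g ∘ f" := (comp g f) (at level 40, left associativity) : cat_scope.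

Record Functor (C D : Category) : Type := {
  fobj :> C -> D;
  fmap : forall a b : C, hom a b -> hom (fobj a) (fobj b);
  fmap_id : forall a : C, fmap (idc a) = idc (fobj a);
  fmap_comp : forall (a b c : C) (g : hom b c) (f : hom a b),
    fmap (g ∘ f) = fmap g ∘ fmap f
}.

Arguments fmap {C D} F {a b} _ : rename.

Definition op (C : Category) : Category := {|
  obj := C;
  hom := fun a b => @hom C b a;
  idc := fun a => @idc C a;
  comp := fun a b c g f => @comp C c b a f g;
  comp_assoc := fun a b c d h g f => eq_sym (comp_assoc f g h);
  comp_id_l := fun a b f => comp_id_r f;
  comp_id_r := fun a b f => comp_id_l f
|}.

Definition op_functor (C D : Category) (F : Functor C D) :
    Functor (op C) (op D) :=
  @Build_Functor (op C) (op D) F (fun a b f => @fmap C D F b a f)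
    (fun a => fmap_id F a) (fun a b c g f => fmap_comp F f g).

Definition comp_functor (C D E : Category) (G : Functor D E) (F : Functor C D) :
  Functor C E.
Proof.
  refine {| fobj := fun a => G (F a); fmap := fun a b f => fmap G (fmap F f) |}.
  - intros a. rewrite fmap_id. apply fmap_id.
  - intros a b c g f. rewrite fmap_comp. apply fmap_comp.
Defined.

Definition Sets : Category := {|
  obj := Type;
  hom := fun A B => A -> B;
  idc := fun A x => x;
  comp := fun A B C g f x => g (f x);
  comp_assoc := fun _ _ _ _ _ _ _ => eq_refl;
  comp_id_l := fun _ _ _ => eq_refl;
  comp_id_r := fun _ _ _ => eq_refl
|}.

Definition Presheaf (C : Category) : Type := Functor (op C) Sets.

Definition restr (C : Category) (E : Presheaf C) (a b : C) (f : hom a b) :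
  E b -> E a := @fmap (op C) Sets E b a f.

Arguments restr {C} E {a b} f _.

Definition is_iso (C : Category) (a b : C) (f : hom a b) : Prop :=
  exists g : hom b a, g ∘ f = idc a /\ f ∘ g = idc b.

Definition cartesian (C D : Category) (p : Functor C D) (c' c : C)
    (phi : hom c' c) : Prop :=
  forall (c'' : C) (psi : hom c'' c) (g : hom (p c'') (p c')),
    fmap p phi ∘ g = fmap p psi ->
    exists! chi : hom c'' c', phi ∘ chi = psi /\ fmap p chi = g.

Definition fibration (C D : Category) (p : Functor C D) : Prop :=
  forall (c : C) (d : D) (f : hom d (p c)),
    exists (c' : C) (phi : hom c' c) (alpha : hom (p c') d),
      cartesian p phi /\ is_iso alpha /\ f ∘ alpha = fmap p phi.

Record Sieve (C : Category) (c : C) : Type := {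
  arrows :> forall a : C, hom a c -> Prop;
  sieve_closed : forall (a b : C) (f : hom b c) (g : hom a b),
    arrows f -> arrows (f ∘ g)
}.

Arguments arrows {C c} S a _ : rename.

Definition maximal (C : Category) (c : C) (S : Sieve c) : Prop :=
  forall (a : C) (f : hom a c), S a f.

Definition pullback (C : Category) (c' c : C) (f : hom c' c) (S : Sieve c) :
  Sieve c'.
Proof.
  refine {| arrows := fun a g => S a (f ∘ g) |}.
  intros a b g h H. rewrite comp_assoc. now apply sieve_closed.
Defined.

Record Topology (C : Category) : Type := {
  covers :> forall c : C, Sieve c -> Prop;
  covers_maximal : forall (c : C) (S : Sieve c), maximal S -> covers S;
  covers_pullback : forall (c' c : C) (f : hom c' c) (S : Sieve c),
    covers S -> covers (pullback f S);
  covers_trans : forall (c : C) (S R : Sieve c), covers S ->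
    (forall (a : C) (f : hom a c), S a f -> covers (pullback f R)) -> covers R
}.

Arguments covers {C} J c _ : rename.

(* A family indexed by the arrows of [S].  Taking [g] to be an identity in
   [matching] shows that a matching family does not depend on the membership
   proofs. *)
Definition family (C : Category) (E : Presheaf C) (c : C) (S : Sieve c) : Type :=
  forall (a : C) (f : hom a c), S a f -> E a.

Definition matching (C : Category) (E : Presheaf C) (c : C) (S : Sieve c)
    (x : family E S) : Prop :=
  forall (a b : C) (f : hom b c) (g : hom a b) (Sf : S b f) (Sfg : S a (f ∘ g)),
    restr E g (x b f Sf) = x a (f ∘ g) Sfg.

Definition amalgamation (C : Category) (E : Presheaf C) (c : C) (S : Sieve c)
    (x : family E S) (e : E c) : Prop :=
  forall (a : C) (f : hom a c) (Sf : S a f), restr E f e = x a f Sf.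

Definition is_sheaf (C : Category) (J : Topology C) (E : Presheaf C) : Prop :=
  forall (c : C) (S : Sieve c), J c S ->
  forall x : family E S, matching x -> exists! e : E c, amalgamation x e.

Definition comorphism (C D : Category) (p : Functor C D)
    (J : Topology C) (K : Topology D) : Prop :=
  forall (c : C) (S : Sieve (p c)), K (p c) S ->
  exists R : Sieve c, J c R /\
    forall (a : C) (f : hom a c), R a f -> S (p a) (fmap p f).

(* By the Yoneda lemma and the universal property of sheafification,
   the presheaf Hom(l'(A(-)), E) is E precomposed with the opposite of A,
   for every K-sheaf E. *)
Definition continuous (C D : Category) (A : Functor C D)
    (J : Topology C) (K : Topology D) : Prop :=
  forall E : Presheaf D, is_sheaf K E ->
    is_sheaf J (comp_functor E (op_functor A)).

(* Intersection of all topologies making p a comorphism; that it is itself one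
   of them, and the least, is proved below. *)
Definition smallest_comorphism_topology (C D : Category) (p : Functor C D)
  (K : Topology D) : Topology C.
Proof.
  refine {| covers := fun c S =>
              forall J : Topology C, comorphism p J K -> J c S |}.
  - intros c S HS J _. now apply covers_maximal.
  - intros c' c f S HS J HJ. apply covers_pullback. now apply HS.
  - intros c S R HS HR J HJ. apply (covers_trans (S := S)).
    + now apply HS.
    + intros a f Sf. now apply HR.
Defined.

Lemma covers_superset (C : Category) (J : Topology C) (c : C) (S R : Sieve c) :
  (forall (a : C) (f : hom a c), S a f -> R a f) -> J c S -> J c R.
Proof.
  intros HSR HS. apply (covers_trans HS). intros a f Sf.
  apply covers_maximal. intros b g. apply sieve_closed. now apply HSR.
Qed.

Definition functor_preimage (C D : Category) (p : Functor C D) (c : C)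
  (T : Sieve (p c)) : Sieve c.
Proof.
  refine {| arrows := fun a f => T (p a) (fmap p f) |}.
  intros a b f g H. rewrite fmap_comp. now apply sieve_closed.
Defined.

Lemma comorphism_preimage (C D : Category) (p : Functor C D)
    (J : Topology C) (K : Topology D) :
  comorphism p J K <->
  forall (c : C) (T : Sieve (p c)), K (p c) T -> J c (functor_preimage T).
Proof.
  split.
  - intros H c T HT. destruct (H c T HT) as [R [HR HRT]].
    exact (covers_superset (S := R) (R := functor_preimage T) HRT HR).
  - intros H c T HT. exists (functor_preimage T). split; [now apply H | easy].
Qed.

Lemma smallest_comorphism_topology_comorphism (C D : Category)
    (p : Functor C D) (K : Topology D) :
  comorphism p (smallest_comorphism_topology p K) K.
Proof.
  apply comorphism_preimage. intros c T HT J HJ.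
  now apply (proj1 (comorphism_preimage p J K) HJ).
Qed.

Lemma smallest_comorphism_topology_least (C D : Category)
    (p : Functor C D) (K : Topology D) (J : Topology C) :
  comorphism p J K ->
  forall (c : C) (S : Sieve c), smallest_comorphism_topology p K c S -> J c S.
Proof. intros HJ c S HS. now apply HS. Qed.

(* Main.v *)
(** Call a sieve S universally effective for a presheaf F if every pullback of
    S satisfies the sheaf condition for F.  These sieves form the finest
    topology for which F is a sheaf, so it suffices to show that, for a
    K-sheaf E, this topology for F = E ∘ p makes p a comorphism; that is, that
    the preimage under p of a K-covering sieve T on p c satisfies the sheaf
    condition for E ∘ p.  A matching family x on the preimage extends to T:
    given f in T, choose a cartesian phi with f ∘ alpha = p phi and transport
    x phi along the inverse of alpha; cartesianness makes this element the only
    one compatible with x. *)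

Require Import Defs.
From Stdlib Require Import IndefiniteDescription.

Set Implicit Arguments.
Unset Strict Implicit.

Lemma restr_id (C : Category) (E : Presheaf C) (a : C) (e : E a) :
  restr E (idc a) e = e.
Proof. exact (f_equal (fun h => h e) (@fmap_id _ _ E a)). Qed.

Lemma restr_comp (C : Category) (E : Presheaf C) (a b c : C)
    (f : hom b c) (g : hom a b) (e : E c) :
  restr E g (restr E f e) = restr E (f ∘ g) e.
Proof.
  symmetry. exact (f_equal (fun h => h e) (@fmap_comp _ _ E c b a g f)).
Qed.

Lemma restr_comp_functor (C D : Category) (E : Presheaf D) (p : Functor C D)
    (a b : C) (f : hom a b) (e : E (p b)) :
  restr (comp_functor E (op_functor p)) f e = restr E (fmap p f) e.
Proof. reflexivity. Qed.

(** Restriction along [idc a] sends both values to the one at [f ∘ idc a], taken with a single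
    membership proof. *)
Lemma matching_eq (C : Category) (E : Presheaf C) (c : C) (S : Sieve c)
    (x : family E S) (a : C) (f f' : hom a c) (Sf : S a f) (Sf' : S a f') :
  matching x -> f = f' -> x a f Sf = x a f' Sf'.
Proof.
  intros Hx <-.
  rewrite <- (restr_id (x a f Sf)), <- (restr_id (x a f Sf')).
  rewrite (Hx _ _ f _ Sf (sieve_closed (idc a) Sf)).
  symmetry. apply Hx.
Qed.

Definition sheaf_for (C : Category) (E : Presheaf C) (c : C) (S : Sieve c) :
    Prop :=
  forall x : family E S, matching x -> exists! e : E c, amalgamation x e.

Lemma sheaf_for_separated (C : Category) (E : Presheaf C) (c : C)
    (S : Sieve c) (e e' : E c) :
  sheaf_for E S ->
  (forall (a : C) (f : hom a c), S a f -> restr E f e = restr E f e') ->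
  e = e'.
Proof.
  intros HS H.
  destruct (HS (fun a f _ => restr E f e)) as [u [_ Hu]].
  - intros a b f g _ _. apply restr_comp.
  - rewrite <- (Hu e), <- (Hu e'); try easy.
    intros a f Sf. symmetry. now apply H.
Qed.

(** For local data known only through a property: unique existence allows a choice of family, and
    stability of [P] under restriction makes it matching. *)
Lemma sheaf_for_glue (C : Category) (E : Presheaf C) (c : C) (S : Sieve c)
    (P : forall a : C, hom a c -> E a -> Prop) :
  sheaf_for E S ->
  (forall (a b : C) (f : hom b c) (g : hom a b) (e : E b),
    P b f e -> P a (f ∘ g) (restr E g e)) ->
  (forall (a : C) (f : hom a c), S a f -> exists! e : E a, P a f e) ->
  exists e : E c, forall (a : C) (f : hom a c), S a f -> P a f (restr E f e).
Proof.
  intros HS Pstable Puniq.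
  pose (y := fun a f Sf =>
    constructive_indefinite_description _ (Puniq a f Sf)).
  destruct (HS (fun a f Sf => proj1_sig (y a f Sf))) as [e [He _]].
  - intros a b f g Sf Sfg.
    destruct (y b f Sf) as [u [Pu Hu]], (y a (f ∘ g) Sfg) as [v [Pv Hv]].
    simpl. symmetry. apply Hv. now apply Pstable.
  - exists e. intros a f Sf. rewrite (He a f Sf).
    exact (proj1 (proj2_sig (y a f Sf))).
Qed.

(* Quantifying over the sieves [R] with the same arrows as [pullback f S]
   avoids transporting along equalities of sieves. *)
Definition universally_effective (C : Category) (E : Presheaf C) (c : C)
    (S : Sieve c) : Prop :=
  forall (a : C) (f : hom a c) (R : Sieve a),
    (forall (b : C) (g : hom b a), R b g <-> S b (f ∘ g)) -> sheaf_for E R.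

Lemma sheaf_for_maximal (C : Category) (E : Presheaf C) (c : C) (S : Sieve c) :
  maximal S -> sheaf_for E S.
Proof.
  intros HS x Hx. exists (x c (idc c) (HS c (idc c))). split.
  - intros a f Sf.
    rewrite (Hx _ _ (idc c) f _ (HS a (idc c ∘ f))).
    apply matching_eq; [exact Hx | apply comp_id_l].
  - intros e He. now rewrite <- He, restr_id.
Qed.

Lemma sheaf_for_pullback_family (C : Category) (E : Presheaf C) (a c : C)
    (R : Sieve c) (x : family E R) (f : hom a c) :
  matching x -> sheaf_for E (pullback f R) ->
  exists! e : E a, forall (b : C) (g : hom b a) (Rfg : R b (f ∘ g)),
    restr E g e = x b (f ∘ g) Rfg.
Proof.
  intros Hx Hf. apply (Hf (fun b g Rfg => x b (f ∘ g) Rfg)).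
  intros b b' g h Rfg Rfgh.
  rewrite (Hx _ _ (f ∘ g) h Rfg (sieve_closed (f := f ∘ g) h Rfg)).
  apply matching_eq; [exact Hx | symmetry; apply comp_assoc].
Qed.

(** Glue [x] over each [pullback f R], then the results over [S]. An arrow [f] of [R] may lie
    outside [S], so the value there is tested on [pullback f S]; this is why [S] must be effective
    universally. *)
Lemma sheaf_for_trans (C : Category) (E : Presheaf C) (c : C) (S R : Sieve c) :
  universally_effective E S ->
  (forall (a : C) (f : hom a c), S a f -> sheaf_for E (pullback f R)) ->
  sheaf_for E R.
Proof.
  intros HS HR x Hx.
  assert (S_sheaf : sheaf_for E S).
  { apply (HS c (idc c)). intros b g. now rewrite comp_id_l. }
  destruct (@sheaf_for_glue C E c S
    (fun a f e => forall b (g : hom b a) (Rfg : R b (f ∘ g)),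
      restr E g e = x b (f ∘ g) Rfg)) as [e He].
  - exact S_sheaf.
  - intros a b f g e He d h Rfgh. rewrite restr_comp.
    assert (Rfgh' : R d (f ∘ (g ∘ h))) by now rewrite comp_assoc.
    rewrite (He d (g ∘ h) Rfgh').
    apply matching_eq; [exact Hx | apply comp_assoc].
  - intros a f Sf. apply sheaf_for_pullback_family; auto.
  - exists e. split.
    + intros a f Rf. apply (sheaf_for_separated (S := pullback f S)).
      { now apply (HS a f). }
      intros b g Sfg. rewrite restr_comp.
      rewrite (Hx _ _ f g Rf (sieve_closed g Rf)).
      (* [He] only controls further restrictions of this element, hence the one along [idc b]. *)
      rewrite <- (restr_id (restr E (f ∘ g) e)).
      assert (Rfg : R b (f ∘ g ∘ idc b)) by now do 2 apply sieve_closed.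
      rewrite (He b (f ∘ g) Sfg b (idc b) Rfg).
      apply matching_eq; [exact Hx | apply comp_id_r].
    + intros e' He'. apply (sheaf_for_separated S_sheaf). intros a f Sf.
      apply (sheaf_for_separated (HR a f Sf)). intros b g Rfg.
      rewrite (He a f Sf b g Rfg), restr_comp. symmetry. apply He'.
Qed.

Definition finest_topology (C : Category) (E : Presheaf C) : Topology C.
Proof.
  refine {| covers := fun c S => universally_effective E S |}.
  - intros c S HS a f R HR. apply sheaf_for_maximal. intros b g.
    apply HR, HS.
  - intros c' c f S HS a g R HR. apply (HS a (f ∘ g)). intros b h.
    rewrite <- comp_assoc. apply HR.
  - intros c S R HS HSR a f R' HR'.
    apply (sheaf_for_trans (S := pullback f S)).
    + intros b g Q HQ. apply (HS b (f ∘ g)). intros d h.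
      rewrite <- comp_assoc. apply HQ.
    + intros b g Sfg. apply (HSR b (f ∘ g) Sfg b (idc b)). intros d h.
      simpl. rewrite comp_id_l, <- comp_assoc. apply HR'.
Defined.

Lemma finest_topology_is_sheaf (C : Category) (E : Presheaf C) :
  is_sheaf (finest_topology E) E.
Proof.
  intros c S HS. apply (HS c (idc c)). intros b g. now rewrite comp_id_l.
Qed.

(* The value at [f] of the extension of [x] along [p], characterized by its
   restrictions to all [g] for which [f ∘ g] comes from [C]. *)
Lemma fibration_extension (C D : Category) (p : Functor C D)
    (Hp : fibration p) (E : Presheaf D) (c : C) (T : Sieve (p c))
    (R : Sieve c) (HR : forall (a : C) (f : hom a c), R a f <-> T (p a) (fmap p f))
    (x : family (comp_functor E (op_functor p)) R) (Hx : matching x)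
    (d : D) (f : hom d (p c)) (Tf : T d f) :
  exists! e : E d, forall (a : C) (psi : hom a c) (g : hom (p a) d)
    (Rpsi : R a psi), f ∘ g = fmap p psi -> restr E g e = x a psi Rpsi.
Proof.
  destruct (Hp c d f) as [c' [phi [alpha [Hphi [[beta [Hba Hab]] Hf]]]]].
  assert (Rphi : R c' phi).
  { apply HR. rewrite <- Hf. now apply sieve_closed. }
  exists (restr E beta (x c' phi Rphi)). split.
  - intros a psi g Rpsi Hg.
    (* Factoring [psi] as [phi ∘ chi] with [chi] over [beta ∘ g] makes [x] at [psi] a restriction of
       [x] at [phi]. *)
    destruct (Hphi a psi (beta ∘ g)) as [chi [[Hpsi Hchi] _]].
    { rewrite <- Hf, <- Hg, <- comp_assoc, (comp_assoc alpha), Hab.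
      now rewrite comp_id_l. }
    rewrite restr_comp, <- Hchi.
    transitivity (x a (phi ∘ chi) (sieve_closed chi Rphi)).
    + rewrite <- restr_comp_functor. apply Hx.
    + exact (matching_eq _ _ Hx Hpsi).
  (* The condition at [phi] and [alpha] fixes [restr E alpha e], hence [e], since [alpha] is
     invertible. *)
  - intros e He. rewrite <- (He c' phi alpha Rphi Hf).
    now rewrite restr_comp, Hab, restr_id.
Qed.

Lemma fibration_sheaf_for_preimage (C D : Category) (p : Functor C D)
    (Hp : fibration p) (K : Topology D) (E : Presheaf D) (HE : is_sheaf K E)
    (c : C) (T : Sieve (p c)) (HT : K (p c) T) (R : Sieve c)
    (HR : forall (a : C) (f : hom a c), R a f <-> T (p a) (fmap p f)) :
  sheaf_for (comp_functor E (op_functor p)) R.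
Proof.
  intros x Hx.
  destruct (@sheaf_for_glue D E (p c) T
    (fun d f e => forall (a : C) (psi : hom a c) (g : hom (p a) d)
      (Rpsi : R a psi), f ∘ g = fmap p psi -> restr E g e = x a psi Rpsi))
    as [e He].
  - exact (HE (p c) T HT).
  - intros d d' f g e He a psi h Rpsi Hh. rewrite restr_comp.
    apply He. now rewrite comp_assoc.
  - intros d f Tf. exact (fibration_extension Hp HR Hx Tf).
  - exists e. split.
    + intros a f Rf. rewrite restr_comp_functor.
      rewrite <- (restr_id (restr E (fmap p f) e)).
      apply He; [now apply HR | apply comp_id_r].
    + intros e' He'. apply (sheaf_for_separated (HE (p c) T HT)).
      intros d f Tf.
      (* Both [e] and [e'] restrict along [f] to the unique extension [u] of [x]. *)
      destruct (fibration_extension Hp HR Hx Tf) as [u [_ Hu]].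
      transitivity u; [symmetry |]; apply Hu.
      * now apply He.
      * intros a psi g Rpsi Hg. rewrite restr_comp, Hg, <- restr_comp_functor. apply He'.
Qed.

Theorem theorem4p44 (C D : Category) (p : Functor C D) (Hp : fibration p)
    (K : Topology D) :
  continuous p (smallest_comorphism_topology p K) K.
Proof.
  (* [HS] ranges over all topologies making [p] a comorphism; [finest_topology] is shown to be
     one. *)
  intros E HE c S HS. apply finest_topology_is_sheaf. apply HS.
  apply comorphism_preimage. intros c' T HT a f R HR.
  (* Pulling the preimage of [T] back along [f] gives the preimage of [pullback (fmap p f) T], again
     a [K]-covering sieve. *)
  apply (fibration_sheaf_for_preimage Hp HE (covers_pullback (fmap p f) HT)).
  intros b g. simpl. rewrite <- fmap_comp. apply HR.
Qed.
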